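(* Let $P_1,P_2,P_3\in\mathbb{R}^2$ be three non-aligned points. The following are equivalent: (i) the set of points $Q\in\mathbb{R}^2$ such that $d(P_1,Q)^2,d(P_2,Q)^2,d(P_3,Q)^2$ are all rational is dense in $\mathbb{R}^2$; (ii) the quadratic form $(x,y)\mapsto \|x\,\overrightarrow{P_1P_3}+y\,\overrightarrow{P_2P_3}\|^2$ has rational coefficients; (iii) the squared distances $d(P_i,P_j)^2$, $i,j\in\{1,2,3\}$, are all rational. Moreover, when these conditions hold, the set of points $Q\in\mathbb{R}^2$ having rational squared distance from each of $P_1,P_2,P_3$ equals $\{P_3+x\,\overrightarrow{P_1P_3}+y\,\overrightarrow{P_2P_3}\,:\,x,y\in\mathbb{Q}\}$.
   Context: $d$ denotes the Euclidean distance on $\mathbb{R}^2$ and $\|\cdot\|$ the Euclidean norm. *)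

(* Defs.v *)
From mathcomp Require Import all_boot all_order all_algebra.
From mathcomp Require Import all_classical all_reals all_analysis.

Set Implicit Arguments.
Unset Strict Implicit.
Unset Printing Implicit Defensive.
Import Order.TTheory GRing.Theory Num.Theory.
Import numFieldNormedType.Exports.
Local Open Scope classical_set_scope.
Local Open Scope ring_scope.

(* The library norm `|u| on row vectors is the sup norm, hence this definition.
   Both norms induce the canonical (product) topology of 'rV[R]_2. *)
Definition eucl_norm (R : realType) (n : nat) (u : 'rV[R]_n) : R :=
  Num.sqrt (\sum_(i < n) u 0 i ^+ 2).

Definition eucl_dist (R : realType) (n : nat) (A B : 'rV[R]_n) : R :=
  eucl_norm (B - A).

Definition collinear (R : realType) (n : nat) (A B C : 'rV[R]_n) : Prop :=
  exists O v : 'rV[R]_n, v != 0 /\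
    {in [:: A; B; C], forall P, exists t : R, P = O + t *: v}.

Definition rational_quadratic_form (R : realType) (q : R -> R -> R) : Prop :=
  exists a b c : R, [/\ rational a, rational b, rational c &
    forall x y : R, q x y = a * x ^+ 2 + b * (x * y) + c * y ^+ 2].

Definition rational_sqdist_set (R : realType) (n : nat) (P1 P2 P3 : 'rV[R]_n) :
    set 'rV[R]_n :=
  [set Q | {in [:: P1; P2; P3], forall P, rational (eucl_dist P Q ^+ 2)}].

(* Main.v *)
Require Import Defs.
From mathcomp Require Import all_boot all_order all_algebra.
From mathcomp Require Import all_classical all_reals all_analysis.
From mathcomp Require Import ring lra.

(* Write [u = P1P3], [v = P2P3], [z = P3Q], [A = |u|^2], [B = 2 <u, v>],
   [C = |v|^2].  Conditions (ii) and (iii) both say that [A], [B], [C] are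
   rational.  The differences of squared distances [m = |P1Q|^2 - |P3Q|^2] and
   [n = |P2Q|^2 - |P3Q|^2] are affine in [Q]; when [A], [B], [C] are rational,
   solving the resulting linear system shows that the coordinates of [z] in the
   basis [(u, v)] are rational.

   For the passage from density to rationality, [|z|^2] is a quadratic polynomial
   in [(m, n)] which takes rational values at rational points that are dense in
   the plane, hence lie on no conic; so six of these points determine its
   coefficients by a rational linear system.  With [D = 4AC - B^2 <> 0], these
   coefficients include [C/D], [-B/D] and [A/D], and then
   [1/D = 4 (A/D) (C/D) - (B/D)^2] gives the rationality of [D], [A], [B], [C]. *)

Import Order.TTheory GRing.Theory Num.Theory.
Import numFieldNormedType.Exports.
Local Open Scope classical_set_scope.
Local Open Scope ring_scope.

(** * Closure of the rationals under field operations *)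

Lemma rational_ratr (R : realType) (q : rat) : rational (ratr q : R).
Proof. by exists q. Qed.

Lemma rationalD (R : realType) (x y : R) :
  rational x -> rational y -> rational (x + y).
Proof. by move=> [p _ <-] [q _ <-]; exists (p + q); rewrite ?rmorphD. Qed.

Lemma rationalN (R : realType) (x : R) : rational x -> rational (- x).
Proof. by move=> [p _ <-]; exists (- p); rewrite ?rmorphN. Qed.

Lemma rationalM (R : realType) (x y : R) :
  rational x -> rational y -> rational (x * y).
Proof. by move=> [p _ <-] [q _ <-]; exists (p * q); rewrite ?rmorphM. Qed.

Lemma rationalV (R : realType) (x : R) : rational x -> rational x^-1.
Proof. by move=> [p _ <-]; exists p^-1; rewrite ?fmorphV. Qed.

Lemma rational_nat (R : realType) (n : nat) : rational (n%:R : R).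
Proof. by exists n%:R; rewrite ?ratr_nat. Qed.

Ltac rational_closure :=
  by rewrite ?expr2; repeat (assumption || apply: rationalD ||
    apply: rationalN || apply: rationalM || apply: rationalV ||
    apply: rational_ratr || apply: rational_nat || apply: (rational_nat _ 1)).

(** * Rational linear systems with a real solution *)

Lemma exists_row_free_pairings (R : realType) (n : nat) (w : 'cV[R]_n) :
  (forall u : 'cV[rat]_n, u != 0 -> exists2 v : 'rV[rat]_n,
     v *m u != 0 & rational ((map_mx ratr v *m w) 0 0)) ->
  forall k, (k <= n)%N -> exists2 A : 'M[rat]_(k, n),
    row_free A & forall i, rational ((map_mx ratr A *m w) i 0).
Proof.
move=> hw; elim=> [|k IH] kn.
  exists 0; last by case.
  by rewrite /row_free mxrank0.
have [A Afree Aw] := IH (ltnW kn).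
(* As [A] has rank [k < n], it kills some nonzero rational column. The hypothesis on that column
   yields a row [v] that does not kill it, and [v] is the row to add. *)
have : cokermx A != 0.
  by rewrite -mxrank_eq0 mxrank_coker (eqP Afree) subn_eq0 -ltnNge.
move=> /eqP/matrixP/existsNP[i0]/existsNP[j /eqP]; rewrite mxE => Aij.
have uN0 : col j (cokermx A) != 0.
  by apply: contra_neq Aij => /matrixP/(_ i0 0); rewrite !mxE.
have [v vu vw] := hw _ uN0.
have Au : A *m col j (cokermx A) = 0 by rewrite colE mulmxA mulmx_coker mul0mx.
rewrite -[k.+1]/(1 + k)%N; exists (col_mx v A).
  apply: inj_row_free => x; rewrite -[x]hsubmxK mul_row_col => xA.
  (* Multiplying the relation by the column killed by [A] isolates the coefficient of [v], which
     must therefore vanish. *)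
  have : lsubmx x *m v *m col j (cokermx A) = 0.
    have := congr1 (mulmx^~ (col j (cokermx A))) xA.
    by rewrite /= mulmxDl mul0mx -[rsubmx x *m A *m _]mulmxA Au mulmx0 addr0.
  rewrite -mulmxA [v *m _]mx11_scalar mul_mx_scalar => /eqP.
  rewrite scaler_eq0 => /orP[/eqP vu0|/eqP xl0].
    by move: vu; rewrite [v *m _]mx11_scalar vu0 raddf0 eqxx.
  move: xA; rewrite xl0 mul0mx add0r => /eqP.
  by rewrite mulmx_free_eq0 // => /eqP ->; rewrite row_mx0.
move=> i; rewrite map_col_mx mul_col_mx; case: (split_ordP i) => i' ->;
  by rewrite ?col_mxEu ?col_mxEd ?(ord1 i').
Qed.

(** The hypothesis says that the rational rows pairing rationally with [w] lie in no rational
    hyperplane. So [n] of them form an invertible rational matrix, and inverting it recovers [w]. *)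
Lemma rational_of_pairings (R : realType) (n : nat) (w : 'cV[R]_n) :
  (forall u : 'cV[rat]_n, u != 0 -> exists2 v : 'rV[rat]_n,
     v *m u != 0 & rational ((map_mx ratr v *m w) 0 0)) ->
  forall i, rational (w i 0).
Proof.
move=> hw i; have [A + Aw] := exists_row_free_pairings _ _ _ hw _ (leqnn n).
rewrite row_free_unit => Aunit.
have -> : w = map_mx ratr (invmx A) *m (map_mx ratr A *m w).
  by rewrite mulmxA -map_mxM mulVmx // map_mx1 mul1mx.
rewrite mxE; elim/big_ind: _ => [|x y|j _].
- exact: (rational_nat R 0).
- exact: rationalD.
- by apply: rationalM => //; rewrite mxE; exact: rational_ratr.
Qed.

(** * Dot products and determinants in the plane *)

Definition dot2 {R : realType} (u v : 'rV[R]_2) : R :=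
  u 0 0 * v 0 0 + u 0 1 * v 0 1.

Definition det2 {R : realType} (u v : 'rV[R]_2) : R :=
  u 0 0 * v 0 1 - u 0 1 * v 0 0.

Lemma sqr_eucl_norm (R : realType) (u : 'rV[R]_2) :
  eucl_norm u ^+ 2 = dot2 u u.
Proof.
rewrite /eucl_norm sqr_sqrtr; last by apply: sumr_ge0 => i _; exact: sqr_ge0.
by rewrite !big_ord_recl big_ord0 addr0 /dot2 !expr2; congr (_ + _ * _);
  congr (u _ _); apply/val_inj.
Qed.

Lemma row2P (R : realType) (u v : 'rV[R]_2) :
  u 0 0 = v 0 0 /\ u 0 1 = v 0 1 -> u = v.
Proof.
move=> [uv0 uv1]; apply/rowP => i; case: (unliftP 0 i) => [j|] -> //.
by rewrite (ord1 j) (_ : lift _ _ = 1) //; apply/val_inj.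
Qed.

Lemma dot2_eq0 (R : realType) (u : 'rV[R]_2) : (dot2 u u == 0) = (u == 0).
Proof.
apply/eqP/eqP => [|->]; last by rewrite /dot2 !mxE !mul0r addr0.
rewrite /dot2 -!expr2 => /eqP.
rewrite paddr_eq0 ?sqr_ge0 // !sqrf_eq0 => /andP[/eqP u0 /eqP u1].
by apply: row2P; rewrite !mxE.
Qed.

Lemma cramer2 (R : realType) (u v z : 'rV[R]_2) : det2 u v != 0 ->
  z = (det2 z v / det2 u v) *: u + (det2 u z / det2 u v) *: v.
Proof.
by move=> detN0; apply: row2P; split; rewrite !mxE;
  rewrite /det2 in detN0 *; field.
Qed.

Lemma dot2_surj (R : realType) (u v : 'rV[R]_2) (p q : R) : det2 u v != 0 ->
  exists z, dot2 z u = p /\ dot2 z v = q.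
Proof.
move=> detN0; exists (\row_i [:: (p * v 0 1 - q * u 0 1) / det2 u v;
  (q * u 0 0 - p * v 0 0) / det2 u v]`_i).
by split; rewrite /dot2 !mxE /=; rewrite /det2 in detN0 *; field.
Qed.

(** Lagrange's identity times 4; it makes [D] nonzero for independent vectors. *)
Lemma gram_det2 (R : realType) (u v : 'rV[R]_2) :
  4 * dot2 u u * dot2 v v - (2 * dot2 u v) ^+ 2 = 4 * det2 u v ^+ 2.
Proof. by rewrite /dot2 /det2; ring. Qed.

Lemma parallel_of_det2_eq0 (R : realType) (u v : 'rV[R]_2) :
  det2 u v = 0 -> exists2 w : 'rV[R]_2, w != 0 &
    exists2 s, u = s *: w & exists t, v = t *: w.
Proof.
move=> det0.
have [u0|uN0] := eqVneq u 0; last first.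
  exists u => //; exists 1; first by rewrite scale1r.
  (* The coefficient of the orthogonal projection of [v] on [u]; after clearing the denominator, the
     error in each coordinate is a multiple of [det2 u v]. *)
  exists (dot2 u v / dot2 u u); apply: row2P.
  have uuN0 : dot2 u u != 0 by rewrite dot2_eq0.
  by split; rewrite !mxE mulrAC; apply/(canRL (mulfK uuN0));
    apply/eqP; rewrite -subr_eq0; apply/eqP;
    [transitivity (- (u 0 1 * det2 u v)) | transitivity (u 0 0 * det2 u v)];
    try (by rewrite det0 mulr0 ?oppr0); rewrite /dot2 /det2; ring.
have [v0|vN0] := eqVneq v 0; last first.
  exists v => //; exists 0; first by rewrite u0 scale0r.
  by exists 1; rewrite scale1r.
(* Both vectors are zero, so any nonzero direction serves. *)
exists (const_mx 1).
  by apply/eqP => /matrixP/(_ 0 0)/eqP; rewrite !mxE oner_eq0.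
by exists 0; [rewrite u0 scale0r|exists 0; rewrite v0 scale0r].
Qed.

Lemma det2_neq0 (R : realType) (P1 P2 P3 : 'rV[R]_2) :
  ~ collinear P1 P2 P3 -> det2 (P3 - P1) (P3 - P2) != 0.
Proof.
move=> Pncol; apply/eqP => det0; apply: Pncol.
have [w wN0 [s us [t vt]]] := parallel_of_det2_eq0 _ _ _ det0.
exists P3, w; split => // P; rewrite !inE => /or3P[] /eqP ->.
- by exists (- s); rewrite scaleNr -us opprB addrC subrK.
- by exists (- t); rewrite scaleNr -vt opprB addrC subrK.
- by exists 0; rewrite scale0r addr0.
Qed.

Lemma dot2_comb (R : realType) (u v : 'rV[R]_2) (x y : R) :
  dot2 (x *: u + y *: v) (x *: u + y *: v) =
  dot2 u u * x ^+ 2 + 2 * dot2 u v * (x * y) + dot2 v v * y ^+ 2.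
Proof. by rewrite /dot2 !mxE; ring. Qed.

(** * Conditions (ii) and (iii) in terms of [A], [B], [C] *)

Lemma rational_formP (R : realType) (u v : 'rV[R]_2) :
  rational_quadratic_form (fun x y : R => eucl_norm (x *: u + y *: v) ^+ 2) <->
  [/\ rational (dot2 u u), rational (2 * dot2 u v) & rational (dot2 v v)].
Proof.
split=> [[a [b [c [ra rb rc q]]]]|[ra rb rc]]; last first.
  exists (dot2 u u), (2 * dot2 u v), (dot2 v v); split => // x y.
  by rewrite sqr_eucl_norm dot2_comb.
have {}q x y : dot2 u u * x ^+ 2 + 2 * dot2 u v * (x * y) + dot2 v v * y ^+ 2 =
  a * x ^+ 2 + b * (x * y) + c * y ^+ 2 by rewrite -dot2_comb -sqr_eucl_norm q.
have := q 1 0; have := q 0 1; have := q 1 1.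
rewrite !expr0n !expr1n /= !mulr0 !mul0r !mulr0 !mulr1 !add0r !addr0.
by move=> q11 vc ua; move: q11; rewrite vc ua => /addIr/addrI ->.
Qed.

Lemma rational_distP (R : realType) (P1 P2 P3 : 'rV[R]_2) :
  {in [:: P1; P2; P3] &, forall A B, rational (eucl_dist A B ^+ 2)} <->
  [/\ rational (dot2 (P3 - P1) (P3 - P1)),
      rational (2 * dot2 (P3 - P1) (P3 - P2)) &
      rational (dot2 (P3 - P2) (P3 - P2))].
Proof.
(* The law of cosines in the triangle, at the vertex [P3]. *)
have E : 2 * dot2 (P3 - P1) (P3 - P2) = dot2 (P3 - P1) (P3 - P1) +
    dot2 (P3 - P2) (P3 - P2) - dot2 (P2 - P1) (P2 - P1).
  by rewrite /dot2 !mxE; ring.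
have distC (A B : 'rV[R]_2) : dot2 (A - B) (A - B) = dot2 (B - A) (B - A).
  by rewrite /dot2 !mxE; ring.
split=> [dist|[ra rb rc]].
  have {}dist A B : A \in [:: P1; P2; P3] -> B \in [:: P1; P2; P3] ->
    rational (dot2 (B - A) (B - A)) by rewrite -sqr_eucl_norm; exact: dist.
  have r1 : rational (dot2 (P3 - P1) (P3 - P1)).
    by apply: dist; rewrite !inE eqxx ?orbT.
  have r2 : rational (dot2 (P3 - P2) (P3 - P2)).
    by apply: dist; rewrite !inE eqxx ?orbT.
  have r3 : rational (dot2 (P2 - P1) (P2 - P1)).
    by apply: dist; rewrite !inE eqxx ?orbT.
  by split => //; rewrite E; rational_closure.
have r12 : rational (dot2 (P2 - P1) (P2 - P1)).
  rewrite (_ : dot2 _ _ = dot2 (P3 - P1) (P3 - P1) +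
    dot2 (P3 - P2) (P3 - P2) - 2 * dot2 (P3 - P1) (P3 - P2)).
    by rational_closure.
  by rewrite E; ring.
have r0 : rational (0 : R) by exact: (rational_nat _ 0).
move=> A B; rewrite /eucl_dist sqr_eucl_norm !inE.
move=> /or3P[] /eqP -> /or3P[] /eqP -> //; rewrite 1?distC //.
all: by rewrite subrr /dot2 !mxE mul0r addr0.
Qed.

(** * Points at rational squared distances *)

Lemma rational_sqdist_setP (R : realType) (P1 P2 P3 Q : 'rV[R]_2) :
  rational_sqdist_set P1 P2 P3 Q <->
  [/\ rational (2 * dot2 (Q - P3) (P3 - P1) + dot2 (P3 - P1) (P3 - P1)),
      rational (2 * dot2 (Q - P3) (P3 - P2) + dot2 (P3 - P2) (P3 - P2)) &
      rational (dot2 (Q - P3) (Q - P3))].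
Proof.
(* Expanding the square of [(Q - P3) + (P3 - P)]: the quadratic part in [Q] does not depend on [P],
   so only an affine condition remains for [P1] and for [P2]. *)
have E (P : 'rV[R]_2) : dot2 (Q - P) (Q - P) = dot2 (Q - P3) (Q - P3) +
    (2 * dot2 (Q - P3) (P3 - P) + dot2 (P3 - P) (P3 - P)).
  by rewrite /dot2 !mxE; ring.
split=> [dist|[r1 r2 r3] P].
  have {}dist P : P \in [:: P1; P2; P3] -> rational (dot2 (Q - P) (Q - P)).
    by rewrite -sqr_eucl_norm; exact: dist.
  have r3 : rational (dot2 (Q - P3) (Q - P3)).
    by apply: dist; rewrite !inE eqxx ?orbT.
  have sub (P : 'rV[R]_2) : P \in [:: P1; P2; P3] ->
      rational (2 * dot2 (Q - P3) (P3 - P) + dot2 (P3 - P) (P3 - P)).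
    move=> /dist; rewrite E => rP.
    by rewrite -[X in rational X](addKr (dot2 (Q - P3) (Q - P3)));
      rational_closure.
  by split => //; apply: sub; rewrite !inE eqxx ?orbT.
rewrite /eucl_dist sqr_eucl_norm !inE => /or3P[] /eqP -> //;
  by rewrite E; rational_closure.
Qed.

Lemma rational_sqdist_setE (R : realType) (P1 P2 P3 : 'rV[R]_2) :
  det2 (P3 - P1) (P3 - P2) != 0 ->
  [/\ rational (dot2 (P3 - P1) (P3 - P1)),
      rational (2 * dot2 (P3 - P1) (P3 - P2)) &
      rational (dot2 (P3 - P2) (P3 - P2))] ->
  rational_sqdist_set P1 P2 P3 =
   [set P3 + x *: (P3 - P1) + y *: (P3 - P2)
     | x in @rational R & y in @rational R].
Proof.
set u := P3 - P1; set v := P3 - P2 => detN0 [ra rb rc].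
have lin (x y : R) : dot2 (x *: u + y *: v) u = dot2 u u * x + dot2 u v * y /\
    dot2 (x *: u + y *: v) v = dot2 u v * x + dot2 v v * y.
  by rewrite /dot2 !mxE; split; ring.
have DN0 : 4 * dot2 u u * dot2 v v - (2 * dot2 u v) ^+ 2 != 0.
  by rewrite gram_det2 mulf_neq0 ?pnatr_eq0 // expf_neq0.
apply/seteqP; split => [Q /rational_sqdist_setP|_ [x rx [y ry <-]]].
  have [x [y Qxy]] : exists x y, Q - P3 = x *: u + y *: v.
    by eexists; eexists; exact: cramer2.
  rewrite -/u -/v Qxy (lin x y).1 (lin x y).2 => -[rm rn _].
  have {}rm := rationalD _ _ _ rm (rationalN _ _ ra).
  have {}rn := rationalD _ _ _ rn (rationalN _ _ rc).
  rewrite !addrK in rm rn.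
  (* Cramer's rule for the Gram system, with factors 2 placed so that only [A], [B], [C] and the
     rational right-hand sides occur. *)
  have xE : x = (2 * dot2 v v * (2 * (dot2 u u * x + dot2 u v * y)) -
      2 * dot2 u v * (2 * (dot2 u v * x + dot2 v v * y))) /
      (4 * dot2 u u * dot2 v v - (2 * dot2 u v) ^+ 2) by field.
  have yE : y = (2 * dot2 u u * (2 * (dot2 u v * x + dot2 v v * y)) -
      2 * dot2 u v * (2 * (dot2 u u * x + dot2 u v * y))) /
      (4 * dot2 u u * dot2 v v - (2 * dot2 u v) ^+ 2) by field.
  exists x; first by rewrite xE; rational_closure.
  exists y; first by rewrite yE; rational_closure.
  by rewrite -addrA -Qxy addrC subrK.
apply/rational_sqdist_setP; rewrite -/u -/v.
rewrite (_ : _ - P3 = x *: u + y *: v); last by rewrite addrC !addrA addNr add0r.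
rewrite (lin x y).1 (lin x y).2 dot2_comb; split.
- rewrite (_ : 2 * _ = 2 * dot2 u u * x + 2 * dot2 u v * y); last by ring.
  by rational_closure.
- rewrite (_ : 2 * _ = 2 * dot2 u v * x + 2 * dot2 v v * y); last by ring.
  by rational_closure.
- by rational_closure.
Qed.

Lemma dense_rational_combs (R : realType) (P u v : 'rV[R]_2) :
  det2 u v != 0 ->
  dense [set P + x *: u + y *: v | x in @rational R & y in @rational R].
Proof.
move=> detN0 O [Q OQ] oO.
have [x0 [y0 Qxy]] : exists x y, Q = P + x *: u + y *: v.
  exists (det2 (Q - P) v / det2 u v), (det2 u (Q - P) / det2 u v).
  rewrite -addrA -(cramer2 _ _ _ (Q - P) detN0).
  by rewrite addrC subrK.
(* Density of the rationals along a curve. It is applied to one coordinate at a time: [x0] is made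
   rational first, then [y0] with the new [x] fixed. *)
have pick (f : R -> 'rV[R]_2) (x : R) : continuous f -> O (f x) ->
    exists2 q : R, rational q & O (f q).
  move=> fcont Ofx; have [] := @dense_rat R (f @^-1` O).
  - by exists x.
  - by apply: open_comp => // z _; exact: fcont.
  - by move=> q [Oq rq]; exists q.
rewrite {Q}Qxy in OQ.
have [x rx Ox] : exists2 x : R, rational x & O (P + x *: u + y0 *: v).
  apply: (pick (fun x => P + x *: u + y0 *: v) x0) => // z.
  apply: cvgD; last exact: cvg_cst.
  by apply: cvgD; [exact: cvg_cst|exact: scalel_continuous].
have [y ry Oxy] : exists2 y : R, rational y & O (P + x *: u + y *: v).
  apply: (pick (fun y => P + x *: u + y *: v) y0) => // z.
  by apply: cvgD; [exact: cvg_cst|exact: scalel_continuous].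
by exists (P + x *: u + y *: v); split => //; exists x => //; exists y.
Qed.

(** * Quadratic polynomials in two variables *)

Definition quad_poly {K : fieldType} (c : nat -> K) (s t : K) : K :=
  c 0%N + c 1%N * s + c 2%N * t + c 3%N * s ^+ 2 + c 4%N * (s * t) +
  c 5%N * t ^+ 2.

Definition quad_monomials {K : fieldType} (s t : K) : 'rV[K]_6 :=
  \row_i [:: 1; s; t; s ^+ 2; s * t; t ^+ 2]`_i.

Lemma quad_monomialsM (K : fieldType) (c : nat -> K) (s t : K) :
  (quad_monomials s t *m \col_i c i) 0 0 = quad_poly c s t.
Proof.
rewrite mxE !big_ord_recl big_ord0 !mxE /= /quad_poly /bump /=.
by ring.
Qed.

Lemma map_quad_poly (R : realType) (c : nat -> rat) (s t : rat) :
  quad_poly (ratr \o c) (ratr s) (ratr t) = ratr (quad_poly c s t) :> R.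
Proof. by rewrite /quad_poly /= !(rmorphD, rmorphM, rmorphXn). Qed.

Lemma map_quad_monomials (R : realType) (s t : rat) :
  map_mx ratr (quad_monomials s t) = quad_monomials (ratr s) (ratr t) :> 'rV[R]_6.
Proof.
apply/rowP => i; rewrite !mxE; case: i => -[|[|[|[|[|[|//]]]]]] /= _;
  by rewrite ?rmorph1 ?rmorphXn ?rmorphM.
Qed.

Lemma quad_poly_nonzero (R : realType) (c : nat -> R) (i : 'I_6) :
  c i != 0 -> exists s t, quad_poly c s t != 0.
Proof.
apply: contraPP => c0.
have {}c0 s t : quad_poly c s t = 0.
  by apply/eqP/negP => /negP cst; apply: c0; exists s, t.
(* No conic contains these six points, so vanishing there forces every coefficient to be zero. *)
have := c0 0 0; have := c0 1 0; have := c0 (-1) 0.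
have := c0 0 1; have := c0 0 (-1); have := c0 1 1; rewrite /quad_poly => *.
suff : c i = 0 by move=> ->; rewrite eqxx.
by case: i => -[|[|[|[|[|[|//]]]]]] /= _; lra.
Qed.

(** A nonzero rational column is the equation of a conic. The points that [(m, n)] sends off this
    conic form a nonempty open set, hence one meeting [S]; the monomials at such a point form the
    row required by [rational_of_pairings]. *)
Lemma rational_quad_coefs (R : realType) (T : topologicalType) (S : set T)
    (m n : T -> R) (c : nat -> R) :
  dense S -> continuous m -> continuous n ->
  (forall s t, exists z, m z = s /\ n z = t) ->
  (forall z, S z -> [/\ rational (m z), rational (n z) &
    rational (quad_poly c (m z) (n z))]) ->
  forall i : 'I_6, rational (c i).
Proof.
move=> Sdense mcont ncont surj rS i.
rewrite (_ : c i = (\col_(i < 6) c i) i 0); last by rewrite mxE.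
move: i.
apply: rational_of_pairings => u uN0.
pose d k : rat := u (inord k) 0.
have uE : u = \col_(i < 6) d i.
  by apply/colP => i; rewrite mxE /d inord_val.
have [i di] : exists i : 'I_6, d i != 0.
  apply: contrapT => d0; move/eqP: uN0; apply; rewrite uE.
  apply/colP => i; rewrite !mxE; apply/eqP/negP => /negP di.
  by apply: d0; exists i.
have [s [t st]] : exists s t : R, quad_poly (ratr \o d) s t != 0.
  by apply: (quad_poly_nonzero _ _ i); rewrite /= fmorph_eq0.
have qcont : continuous (fun z => quad_poly (ratr \o d) (m z) (n z)).
  rewrite /quad_poly => z; repeat first [apply: cvgD | apply: cvgM |
    exact: cvg_cst | exact: mcont | exact: ncont].
have [] := Sdense ((fun z => quad_poly (ratr \o d) (m z) (n z)) @^-1`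
  [set x | x != 0]).
- by have [z [mz nz]] := surj s t; exists z; rewrite /= mz nz.
- by apply: open_comp; [move=> z _; exact: qcont|exact: open_neq].
move=> z [/= qz /rS[[p _ mz] [q _ nz]]]; rewrite -mz -nz in qz *.
exists (quad_monomials p q).
  apply: contraNN qz => /eqP; rewrite uE => /matrixP/(_ 0 0).
  by rewrite quad_monomialsM mxE map_quad_poly => ->; rewrite rmorph0.
by rewrite map_quad_monomials quad_monomialsM.
Qed.

(** * From density to rational [A], [B], [C] *)

Lemma continuous_affine_dot2 (R : realType) (P w : 'rV[R]_2) (a : R) :
  continuous (fun Q : 'rV[R]_2 => 2 * dot2 (Q - P) w + a).
Proof.
have comb (T : topologicalType) (f g : T -> R) : continuous f -> continuous g ->
    continuous (fun Q => 2 * ((f Q - P 0 0) * w 0 0 + (g Q - P 0 1) * w 0 1) + a).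
  move=> fcont gcont Q; repeat first [exact: cvg_cst | exact: fcont |
    exact: gcont | apply: cvgD | apply: cvgM].
rewrite (_ : (fun _ => _) = fun Q : 'rV[R]_2 => 2 * ((Q 0 0 - P 0 0) * w 0 0 +
  (Q 0 1 - P 0 1) * w 0 1) + a); last by apply/funext => Q; rewrite /dot2 !mxE.
by apply: comb; exact: coord_continuous.
Qed.

Lemma rational_gram_of_dense (R : realType) (P1 P2 P3 : 'rV[R]_2) :
  det2 (P3 - P1) (P3 - P2) != 0 -> dense (rational_sqdist_set P1 P2 P3) ->
  [/\ rational (dot2 (P3 - P1) (P3 - P1)),
      rational (2 * dot2 (P3 - P1) (P3 - P2)) &
      rational (dot2 (P3 - P2) (P3 - P2))].
Proof.
move=> + Sdense.
have : forall Q, rational_sqdist_set P1 P2 P3 Q -> _ :=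
  fun Q => (rational_sqdist_setP _ _ _ _ _).1.
move: (P3 - P1) (P3 - P2) => u v rS detN0.
set A := dot2 u u; set B := 2 * dot2 u v; set C := dot2 v v.
have DN0 : 4 * A * C - B ^+ 2 != 0.
  by rewrite gram_det2 mulf_neq0 ?pnatr_eq0 // expf_neq0.
set D := 4 * A * C - B ^+ 2 in DN0.
pose m Q := 2 * dot2 (Q - P3) u + A; pose n Q := 2 * dot2 (Q - P3) v + C.
(* Inverting the Gram matrix gives [D |z|^2 = C M^2 - B M N + A N^2] with [M = m - A] and
   [N = n - C]; these are its coefficients in [m] and [n], divided by [D]. *)
pose c k : R := [:: (A ^+ 2 * C - A * B * C + A * C ^+ 2) / D;
  (B * C - 2 * A * C) / D; (A * B - 2 * A * C) / D; C / D; - B / D; A / D]`_k.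
have rc : forall i : 'I_6, rational (c i).
  apply: (rational_quad_coefs _ _ (rational_sqdist_set P1 P2 P3) m n c) => //.
  - exact: continuous_affine_dot2.
  - exact: continuous_affine_dot2.
  - move=> s t; have [z [zu zv]] :=
      dot2_surj _ u v ((s - A) / 2) ((t - C) / 2) detN0.
    by exists (P3 + z); rewrite /m /n [P3 + z]addrC addrK zu zv; split; field.
  - move=> Q /rS[rm rn rQ]; split => //.
    rewrite (_ : quad_poly _ _ _ = dot2 (Q - P3) (Q - P3)) //.
    apply: (mulfI DN0); transitivity (C * (m Q - A) ^+ 2 -
        B * ((m Q - A) * (n Q - C)) + A * (n Q - C) ^+ 2).
      by rewrite /quad_poly /c /=; field.
    by rewrite /D /m /n /A /B /C /dot2; ring.
have rCD : rational (C / D) := rc 3%R.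
have rBD : rational (- B / D) := rc 4%R.
have rAD : rational (A / D) := rc 5%R.
have DE : D = (4 * (A / D) * (C / D) - (- B / D) * (- B / D))^-1.
  apply: invr_inj; rewrite invrK; apply: (mulfI DN0); rewrite divff //.
  by transitivity ((4 * A * C - B ^+ 2) / D); [rewrite divff|field].
have rD : rational D by rewrite DE; rational_closure.
split.
- by rewrite -[A](divfK DN0); rational_closure.
- by rewrite -[B]opprK -[- B](divfK DN0); rational_closure.
- by rewrite -[C](divfK DN0); rational_closure.
Qed.

Theorem theorem1p2 (R : realType) (P1 P2 P3 : 'rV[R]_2)
    (hP : ~ collinear P1 P2 P3) :
  let dense_condition := dense (rational_sqdist_set P1 P2 P3) in
  let form_condition := rational_quadratic_form
    (fun x y : R => eucl_norm (x *: (P3 - P1) + y *: (P3 - P2)) ^+ 2) in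
  let distance_condition :=
    {in [:: P1; P2; P3] &, forall A B, rational (eucl_dist A B ^+ 2)} in
  [<-> dense_condition; form_condition; distance_condition] /\
  (dense_condition /\ form_condition /\ distance_condition ->
   rational_sqdist_set P1 P2 P3 =
   [set P3 + x *: (P3 - P1) + y *: (P3 - P2)
     | x in @rational R & y in @rational R]).
Proof.
move=> dense_condition form_condition distance_condition.
have detN0 := det2_neq0 _ _ _ _ hP.
have formP := rational_formP _ (P3 - P1) (P3 - P2).
have distP := rational_distP _ P1 P2 P3.
split.
  tfae.
  - by move=> Sdense; apply/formP; exact: rational_gram_of_dense.
  - by move/formP => gram; exact/distP.
  - move/distP => gram; rewrite /dense_condition rational_sqdist_setE //.
    exact: dense_rational_combs.
by move=> [_ [_ /distP gram]]; exact: rational_sqdist_setE.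
Qed.
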